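(* For every integer $n \geq 1$ there exists a real $2$-step nilpotent Lie algebra which has exactly $n$ different bi-invariant complex structures; that is, there exists a $2$-step nilpotent Lie algebra $\mathfrak{m}$ over $\mathbb{R}$ such that there are, up to isomorphism of complex Lie algebras, exactly $n$ complex Lie algebras $\mathfrak{g}$ with $\mathfrak{g}_{\mathbb{R}} \cong \mathfrak{m}$ as real Lie algebras.
   Context: For a complex Lie algebra $\mathfrak{g}$, the underlying real Lie algebra $\mathfrak{g}_{\mathbb{R}}$ is $\mathfrak{g}$ regarded as a Lie algebra over $\mathbb{R}$ by restricting the scalar multiplication. A complex Lie algebra $\mathfrak{g}$ with $\mathfrak{g}_{\mathbb{R}} \cong \mathfrak{m}$ is said to be given by a bi-invariant complex structure on $\mathfrak{m}$; bi-invariant complex structures are counted up to isomorphism of the corresponding complex Lie algebras. *)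

(* Defs.v *)
From HB Require Import structures.
From mathcomp Require Import all_boot all_order all_algebra.
From mathcomp Require Import classical_sets reals.
From mathcomp.real_closed Require Import complex.
Set Implicit Arguments.
Unset Strict Implicit.
Unset Printing Implicit Defensive.
Import GRing.Theory.
Local Open Scope ring_scope.
Local Open Scope classical_set_scope.
Local Open Scope complex_scope.

(* No finiteness of the dimension is built in. *)
HB.mixin Record isLieAlgebra (K : fieldType) L & GRing.Lmodule K L := {
  lie_bracket : L -> L -> L ;
  lie_linearl : forall y, linear (lie_bracket^~ y) ;
  lie_linearr : forall x, linear (lie_bracket x) ;
  lie_alternating : forall x, lie_bracket x x = 0 ;
  lie_jacobi : forall x y z,
    lie_bracket x (lie_bracket y z) + lie_bracket y (lie_bracket z x)
      + lie_bracket z (lie_bracket x y) = 0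
}.

#[short(type="lieAlgType")]
HB.structure Definition LieAlgebra (K : fieldType) :=
  { L of GRing.Lmodule K L & isLieAlgebra K L }.

Definition lie_isomorphic (K : fieldType) (g h : lieAlgType K) : Prop :=
  exists f : {linear g -> h},
    bijective f /\
    forall x y, f (lie_bracket x y) = lie_bracket (f x) (f y).

Definition lin_span (K : fieldType) (V : lmodType K) (S : set V) : set V :=
  [set v | exists (n : nat) (c : 'I_n -> K) (w : 'I_n -> V),
     (forall i, S (w i)) /\ v = \sum_(i < n) c i *: w i].

Definition finite_dimensional (K : fieldType) (V : lmodType K) : Prop :=
  exists s : seq V, lin_span [set` s] = setT.

(* Indexed from 0: lower_central g 0 is g itself, lower_central g 1 is the
   derived algebra. *)
Fixpoint lower_central (K : fieldType) (g : lieAlgType K) (k : nat) : set g :=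
  if k is j.+1 then
    lin_span [set z | exists x y : g,
                @lower_central K g j y /\ z = lie_bracket x y]
  else setT.
Arguments lower_central {K} g k _.

(* Nilpotency class exactly k; in particular a 2-step nilpotent Lie algebra is
   not abelian. *)
Definition step_nilpotent (K : fieldType) (k : nat) (g : lieAlgType K) : Prop :=
  lower_central g k = [set 0] /\
  forall j, (j < k)%N -> lower_central g j <> [set 0].

Definition realification (R : rcfType) (V : lmodType R[i]) : Type := V.

Section RealificationLmodule.
Variables (R : rcfType) (V : lmodType R[i]).

HB.instance Definition _ := GRing.Zmodule.on (realification V).

Definition realification_scale (a : R) (v : realification V) :
  realification V := a%:C *: (v : V).

Fact realification_scaleA a b v :
  realification_scale a (realification_scale b v)
    = realification_scale (a * b) v.
Proof. by rewrite /realification_scale scalerA rmorphM. Qed.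

Fact realification_scale1 : left_id 1 realification_scale.
Proof. by move=> v; rewrite /realification_scale rmorph1 scale1r. Qed.

Fact realification_scaleDr : right_distributive realification_scale +%R.
Proof. by move=> a u v; rewrite /realification_scale scalerDr. Qed.

Fact realification_scaleDl v :
  {morph realification_scale^~ v : a b / a + b}.
Proof. by move=> a b; rewrite /realification_scale rmorphD scalerDl. Qed.

HB.instance Definition _ := GRing.Zmodule_isLmodule.Build R (realification V)
  realification_scaleA realification_scale1
  realification_scaleDr realification_scaleDl.

End RealificationLmodule.

Section RealificationLie.
Variables (R : rcfType) (g : lieAlgType R[i]).

Definition realification_bracket (x y : realification g) : realification g :=
  lie_bracket (x : g) (y : g).

Fact realification_linearl (y : realification g) :
  linear (realification_bracket^~ y).
Proof. by move=> a u v; apply: (lie_linearl (y : g)). Qed.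

Fact realification_linearr (x : realification g) :
  linear (realification_bracket x).
Proof. by move=> a u v; apply: (lie_linearr (x : g)). Qed.

Fact realification_alternating (x : realification g) :
  realification_bracket x x = 0.
Proof. exact: (lie_alternating (x : g)). Qed.

Fact realification_jacobi (x y z : realification g) :
  realification_bracket x (realification_bracket y z)
    + realification_bracket y (realification_bracket z x)
    + realification_bracket z (realification_bracket x y) = 0.
Proof. exact: (lie_jacobi (x : g) (y : g) (z : g)). Qed.

HB.instance Definition _ := isLieAlgebra.Build R (realification g)
  realification_linearl realification_linearr
  realification_alternating realification_jacobi.

End RealificationLie.

(* The complex Lie algebra g is given by a bi-invariant complex structure
   on m. *)
Definition bi_invariant_on (R : rcfType) (m : lieAlgType R)
    (g : lieAlgType R[i]) : Prop :=
  lie_isomorphic (realification g) m.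

Definition exactly_n_bi_invariant (R : rcfType) (m : lieAlgType R) (n : nat) :
    Prop :=
  exists g : 'I_n -> lieAlgType R[i],
    [/\ forall i, bi_invariant_on m (g i),
        forall i j, lie_isomorphic (g i) (g j) -> i = j
      & forall h : lieAlgType R[i], bi_invariant_on m h ->
          exists i, lie_isomorphic h (g i)].

(* Main.v *)
Require Import Defs.
From HB Require Import structures.
From mathcomp Require Import all_boot all_order all_algebra.
From mathcomp Require Import classical_sets reals.
From mathcomp.real_closed Require Import complex.
From mathcomp Require Import perm ring lra.
Set Implicit Arguments.
Unset Strict Implicit.
Unset Printing Implicit Defensive.
Import GRing.Theory.
Local Open Scope ring_scope.
Local Open Scope complex_scope.

(* Glue Heisenberg algebras along their centres: for vectors p_i spanning W, let
   g(p) have generators x_i, y_i and central part W, with [x_i, y_i] = p_i the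
   only nonzero brackets of generators.  Modulo W, an operator J on g(p)_R with
   J^2 = -1 and J[v, w] = [Jv, w] = [v, Jw] must be +i or -i on each plane
   <x_i, y_i>, with equal signs on planes whose p_i share a coordinate; so the
   complex forms of g(p)_R are the algebras g(p') where each p_i is conjugated
   or not.
   Take a sum of n blocks, each made of the four vectors (1,0), (0,1), (1,1),
   (1,l) of its own copy of C^2, with l = 2 in one block and l = 2i or -2i in
   the n - 1 others.  Conjugation exchanges 2i and -2i and blocks can be
   permuted, so at most n forms remain, according to the number of l = 2i.
   Conversely the lines C p_i are the images [x, g] of the elements x with
   dim [x, g] = 1, so an isomorphism permutes them; it respects the linear
   dependencies, hence the blocks, and the cross ratios up to reordering, and no
   reordering turns cross ratio 2i into 2 or -2i. *)

(* (v, z) stands for sum_i (v (i, true) x_i + v (i, false) y_i) + z. *)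
Definition amalgam (K : fieldType) (I J : finType) (p : I -> J -> K) : Type :=
  ({ffun I * bool -> K^o} * {ffun J -> K^o})%type.

(** * Amalgams as Lie algebras *)

Section Amalgam.
Variables (K : fieldType) (I J : finType) (p : I -> J -> K).

HB.instance Definition _ := Vector.on (amalgam p).

Definition central (z : {ffun J -> K^o}) : amalgam p := (0, z).

Definition symp (v w : {ffun I * bool -> K^o}) (i : I) : K :=
  v (i, true) * w (i, false) - v (i, false) * w (i, true).

Definition amalgam_bracket (v w : amalgam p) : amalgam p :=
  central [ffun j => \sum_i symp v.1 w.1 i * p i j].

Fact amalgam_linearl w : linear (amalgam_bracket^~ w).
Proof.
move=> a u v; congr pair; first by rewrite /= scaler0 addr0.
apply/ffunP => j; rewrite !ffunE /= scaler_sumr -big_split /=.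
apply: eq_bigr => i _; rewrite /symp /= !ffunE /GRing.scale /=; ring.
Qed.

Fact amalgam_linearr v : linear (amalgam_bracket v).
Proof.
move=> a u w; congr pair; first by rewrite /= scaler0 addr0.
apply/ffunP => j; rewrite !ffunE /= scaler_sumr -big_split /=.
apply: eq_bigr => i _; rewrite /symp /= !ffunE /GRing.scale /=; ring.
Qed.

Fact amalgam_alternating v : amalgam_bracket v v = 0.
Proof.
congr pair; apply/ffunP => j; rewrite !ffunE big1 // => i _.
by rewrite /symp; ring.
Qed.

Lemma amalgam_bracket_central v z : amalgam_bracket v (central z) = 0.
Proof.
congr pair; apply/ffunP => j; rewrite !ffunE big1 // => i _.
by rewrite /symp /= !ffunE; ring.
Qed.

Fact amalgam_jacobi u v w :
  amalgam_bracket u (amalgam_bracket v w)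
    + amalgam_bracket v (amalgam_bracket w u)
    + amalgam_bracket w (amalgam_bracket u v) = 0.
Proof. by rewrite !amalgam_bracket_central !addr0. Qed.

HB.instance Definition _ := isLieAlgebra.Build K (amalgam p)
  amalgam_linearl amalgam_linearr amalgam_alternating amalgam_jacobi.

Definition gen (x : I * bool) : amalgam p := ([ffun y => (y == x)%:R], 0).

Definition pt (i : I) : amalgam p := central [ffun j => p i j].

Definition bsgn (t : bool) : K := if t then 1 else -1.

Lemma bracketE (v w : amalgam p) : lie_bracket v w = amalgam_bracket v w.
Proof. by []. Qed.

(** Bracketing with one generator of a plane reads off the coordinate along the other, up to the
    sign in [symp]. This is how coordinates are later recovered from brackets. *)
Lemma bracket_gen (v : amalgam p) i t :
  lie_bracket v (gen (i, ~~ t)) = (bsgn t * v.1 (i, t)) *: pt i.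
Proof.
congr pair; rewrite /= ?scaler0 //; apply/ffunP=> j.
rewrite !ffunE (bigD1 i) //= big1 => [|k ki].
  rewrite /symp !ffunE !xpair_eqE eqxx /=.
  by case: t; rewrite /= /GRing.scale /=; ring.
rewrite /symp !ffunE !xpair_eqE (negbTE ki) /=; ring.
Qed.

Lemma gen_bracket (v : amalgam p) i t :
  lie_bracket (gen (i, ~~ t)) v = - (bsgn t * v.1 (i, t)) *: pt i.
Proof.
congr pair; rewrite /= ?scaler0 //; apply/ffunP=> j.
rewrite !ffunE (bigD1 i) //= big1 => [|k ki].
  rewrite /symp !ffunE !xpair_eqE eqxx /=.
  by case: t; rewrite /= /GRing.scale /=; ring.
rewrite /symp !ffunE !xpair_eqE (negbTE ki) /=; ring.
Qed.

End Amalgam.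

(** * Isomorphisms of Lie algebras, and relabelling of amalgams *)

Section LieIsomorphic.
Variable K : fieldType.
Implicit Types g h k : lieAlgType K.

Lemma lie_isomorphicI g h (f : g -> h) :
  linear f -> bijective f ->
  (forall x y, f (lie_bracket x y) = lie_bracket (f x) (f y)) ->
  lie_isomorphic g h.
Proof.
move=> f_lin f_bij f_br.
pose f' : {linear g -> h} :=
  HB.pack f (GRing.isLinear.Build K g h *:%R f f_lin).
by exists f'.
Qed.

Lemma lie_morph_inv g h (f : {linear g -> h}) (f' : h -> g) :
  cancel f f' -> cancel f' f ->
  (forall x y, f (lie_bracket x y) = lie_bracket (f x) (f y)) ->
  linear f' /\ forall x y, f' (lie_bracket x y) = lie_bracket (f' x) (f' y).
Proof.
move=> fK f'K f_br; split=> [a x y|x y]; apply: (can_inj fK).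
  by rewrite linearP !f'K.
by rewrite f_br !f'K.
Qed.

Lemma lie_isomorphic_sym g h : lie_isomorphic g h -> lie_isomorphic h g.
Proof.
move=> [f [[f' fK f'K] f_br]].
have [f'_lin f'_br] := lie_morph_inv fK f'K f_br.
by apply: (lie_isomorphicI f'_lin) => //; exists f.
Qed.

Lemma lie_isomorphic_trans g h k :
  lie_isomorphic g h -> lie_isomorphic h k -> lie_isomorphic g k.
Proof.
move=> [f [f_bij f_br]] [f' [f'_bij f'_br]].
exists (f' \o f : {linear _ -> _}); split=> [|x y]; first exact: bij_comp.
by rewrite /= f_br f'_br.
Qed.

End LieIsomorphic.

Lemma amalgam_reindex (K : fieldType) (I J I' J' : finType)
    (p : I -> J -> K) (p' : I' -> J' -> K) (s : I -> I') (t : J -> J') :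
  bijective s -> bijective t -> (forall i j, p' (s i) (t j) = p i j) ->
  lie_isomorphic (amalgam p') (amalgam p).
Proof.
move=> [s' sK s'K] [t' tK t'K] pE.
pose f (v : amalgam p') : amalgam p :=
  ([ffun x => v.1 (s x.1, x.2)], [ffun j => v.2 (t j)]).
pose f' (v : amalgam p) : amalgam p' :=
  ([ffun x => v.1 (s' x.1, x.2)], [ffun j => v.2 (t' j)]).
apply: (@lie_isomorphicI _ _ _ f).
- by move=> a u v; congr pair; apply/ffunP => x; rewrite !ffunE.
- exists f'; case=> v e; congr pair; apply/ffunP; first [case=> i b | move=> j];
    by rewrite !ffunE /= ?sK ?s'K ?tK ?t'K.
move=> v w; congr pair; apply/ffunP => j; rewrite !ffunE //=.
rewrite (reindex s) /=; last by exists s' => *.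
by apply: eq_bigr => i _; rewrite pE /symp !ffunE.
Qed.

(** * Dimension and nilpotency class *)

Lemma mem_lin_span (K : fieldType) (V : lmodType K) (S : set V) v :
  S v -> lin_span S v.
Proof.
move=> Sv; exists 1%N, (fun=> 1), (fun=> v); split=> //.
by rewrite big_ord1 scale1r.
Qed.

Lemma lin_span_set0 (K : fieldType) (V : lmodType K) (S : set V) :
  (forall v, S v -> v = 0) -> lin_span S = [set 0]%classic.
Proof.
move=> S0; apply/seteqP; split=> v /=.
  move=> [n [c [w [Sw ->]]]]; rewrite big1 // => i _.
  by rewrite (S0 _ (Sw i)) scaler0.
move=> ->; exists 0%N, (fun=> 0), (fun=> 0); split=> [[]|] //.
by rewrite big_ord0.
Qed.

(** If [b] spans over the complex numbers, then [b] and its multiples by ['i] span over the reals: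
    split each coefficient into real and imaginary part. *)
Lemma finite_dimensional_realification (R : rcfType) (g : lieAlgType R[i]) :
  finite_dimensional g -> finite_dimensional (realification g).
Proof.
move=> [b b_span]; exists (b ++ [seq 'i *: x | x <- b] : seq g).
apply/seteqP; split=> // v _.
have [n [c [w [wb ->]]]] : lin_span [set` b]%classic (v : g) by rewrite b_span.
exists (n + n)%N,
  (fun k => match fintype.split k with
            | inl i => Re (c i) | inr i => Im (c i) end),
  (fun k => match fintype.split k with
            | inl i => w i | inr i => 'i *: w i end); split.
  move=> k; rewrite /= mem_cat.
  case: fintype.split => i; apply/orP; [left|right]; first exact: wb.
  by apply: map_f; exact: wb.
rewrite big_split_ord /= -big_split /=; apply: eq_bigr => i _.
rewrite -[lshift _ _]/(unsplit (inl i)) -[rshift _ _]/(unsplit (inr i)).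
rewrite !unsplitK.
by rewrite {1}[c i]complexE scalerDl mulrC -scalerA.
Qed.

Lemma amalgam_finite_dimensional (K : fieldType) (I J : finType)
    (p : I -> J -> K) : finite_dimensional (amalgam p).
Proof.
exists (vbasis {:amalgam p}); apply/seteqP; split=> // v _.
exists (\dim {:amalgam p}), (fun i => coord (vbasis {:amalgam p}) i v),
  (fun i => (vbasis {:amalgam p})`_i); split.
  by move=> i; rewrite /= mem_nth ?size_tuple.
exact: coord_vbasis (memvf v).
Qed.

Lemma amalgam_realification_step2 (R : rcfType) (I J : finType)
    (p : I -> J -> R[i]) (i : I) (j : J) : p i j != 0 ->
  step_nilpotent 2 (realification (amalgam p)).
Proof.
move=> pij; have pt0 : pt p i <> 0.
  by move=> [] /ffunP/(_ j); rewrite !ffunE => /eqP; rewrite (negbTE pij).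
have br : pt p i = lie_bracket (gen p (i, true)) (gen p (i, ~~ true)).
  by rewrite bracket_gen ffunE eqxx mulr1 scale1r.
split.
  apply: lin_span_set0 => z [x [y [[n [c [w [wE ->]]]] ->]]].
  rewrite /lie_bracket /= /realification_bracket bracketE.
  set s := (X in amalgam_bracket _ X).
  (* [s] is a real combination of brackets, so it has no generator part. *)
  suff -> : s = central p s.2 by exact: amalgam_bracket_central.
  rewrite /s; apply: (big_ind (fun u : realification (amalgam p) =>
      u = central p (u : amalgam p).2)) => //.
  - by move=> ? ? -> ->; congr pair; rewrite /= addr0.
  - move=> k _; have [u [v [_ ->]]] := wE k.
    by congr pair; apply: scaler0.
case=> [|[|//]] _.
  by move=> /seteqP[/(_ (pt p i) Logic.I)].
move=> /seteqP[+ _] => /(_ (pt p i)) H; apply: pt0; apply: H.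
apply: mem_lin_span; exists (gen p (i, true)), (gen p (i, false)); split=> //.
Qed.

(** * Scalars in brackets, and coordinates of sums *)

Section BracketTheory.
Variables (K : fieldType) (g : lieAlgType K).
Implicit Types x y : g.

Lemma lie_bracket0l y : lie_bracket (0 : g) y = 0.
Proof.
have := lie_linearl y 1 (0 : g) 0; rewrite /= !scale1r addr0 => H.
by apply: (addrI (lie_bracket 0 y)); rewrite -H addr0.
Qed.

Lemma lie_bracket0r x : lie_bracket x (0 : g) = 0.
Proof.
have := lie_linearr x 1 (0 : g) 0; rewrite /= !scale1r addr0 => H.
by apply: (addrI (lie_bracket x 0)); rewrite -H addr0.
Qed.

Lemma lie_bracketZl a x y : lie_bracket (a *: x) y = a *: lie_bracket x y.
Proof. by have := lie_linearl y a x 0; rewrite /= lie_bracket0l !addr0. Qed.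

Lemma lie_bracketZr a x y : lie_bracket x (a *: y) = a *: lie_bracket x y.
Proof. by have := lie_linearr x a y 0; rewrite /= lie_bracket0r !addr0. Qed.

End BracketTheory.

Lemma pt_scale_inj (K : fieldType) (I J : finType) (p : I -> J -> K) i j :
  p i j != 0 -> injective (fun a : K => a *: pt p i).
Proof.
move=> pij a b [] _ /ffunP/(_ j); rewrite !ffunE.
exact: mulIf.
Qed.

Section Coordinates.
Variables (K : fieldType) (I J : finType) (p : I -> J -> K).

Lemma amalgam_ext (v w : amalgam p) :
  (forall x, v.1 x = w.1 x) -> (forall j, v.2 j = w.2 j) -> v = w.
Proof.
by case: v w => [a z] [b u] /= /ffunP ab /ffunP zu; congr pair.
Qed.

Lemma sum_coord1 (T : finType) (f : T -> amalgam p) x :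
  (\sum_t f t).1 x = \sum_t (f t).1 x.
Proof.
by apply: (big_morph (fun u : amalgam p => u.1 x)) => [u v|]; rewrite ffunE.
Qed.

Lemma sum_coord2 (T : finType) (f : T -> amalgam p) j :
  (\sum_t f t).2 j = \sum_t (f t).2 j.
Proof.
by apply: (big_morph (fun u : amalgam p => u.2 j)) => [u v|]; rewrite ffunE.
Qed.

End Coordinates.

(** * Conjugation on realifications of amalgams *)

Section Conjugation.
Variable R : rcfType.

Definition cj (b : bool) : {rmorphism R[i] -> R[i]} :=
  if b then (@conjc R : {rmorphism R[i] -> R[i]}) else idfun.

Lemma cjK b : involutive (cj b).
Proof. by case: b => x //; exact: conjcK. Qed.

Lemma cj_real b (a : R) : cj b a%:C = a%:C.
Proof. by case: b => //; exact: conjc_real. Qed.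

(** Conjugate plane [i] according to [s i] and central coordinate [j] according to [t j]. This is
    real linear, and it respects brackets because the two choices agree wherever plane [i]
    contributes to coordinate [j]. *)
Lemma amalgam_conj (I J : finType) (p p' : I -> J -> R[i])
    (s : I -> bool) (t : J -> bool) :
  (forall i j, p' i j = cj (s i) (p i j)) ->
  (forall i j, p i j != 0 -> s i = t j) ->
  lie_isomorphic (realification (amalgam p')) (realification (amalgam p)).
Proof.
move=> p'E st.
pose f (v : realification (amalgam p')) : realification (amalgam p) :=
  ([ffun x => cj (s x.1) ((v : amalgam p').1 x)],
   [ffun j => cj (t j) ((v : amalgam p').2 j)]).
pose f' (v : realification (amalgam p)) : realification (amalgam p') :=
  ([ffun x => cj (s x.1) ((v : amalgam p).1 x)],
   [ffun j => cj (t j) ((v : amalgam p).2 j)]).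
apply: (@lie_isomorphicI _ _ _ f).
- move=> a u v; congr pair; apply/ffunP => x; rewrite !ffunE /= rmorphD;
    by congr (_ + _); rewrite /GRing.scale /= rmorphM /= cj_real.
- exists f'; case=> v e; congr pair; apply/ffunP => x;
    by rewrite !ffunE /= cjK.
move=> v w; congr pair; apply/ffunP => j; rewrite !ffunE /= ?rmorph0 //.
rewrite rmorph_sum; apply: eq_bigr => i _; rewrite p'E rmorphM /=.
have [->|/st <-] := eqVneq (p i j) 0; first by rewrite !rmorph0 !mulr0.
by rewrite cjK /symp !ffunE rmorphB !rmorphM.
Qed.

(** * Complex structures on the realification of an amalgam *)

Section Classification.
Variables (I J : finType) (p : I -> J -> R[i]) (e : J -> I).
Hypothesis p_neq0 : forall i, exists j, p i j != 0.
Hypothesis p_basis : forall j j', p (e j) j' = (j' == j)%:R.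
Variables (h : lieAlgType R[i]).
Variable phi : {linear realification h -> realification (amalgam p)}.
Variable psi : realification (amalgam p) -> realification h.
Hypotheses (phiK : cancel phi psi) (psiK : cancel psi phi).
Hypothesis phi_br : forall x y,
  phi (lie_bracket x y) = lie_bracket (phi x) (phi y).

Let psi_lin : linear psi.
Proof. exact: (lie_morph_inv phiK psiK phi_br).1. Qed.

Let psi_br x y : psi (lie_bracket x y) = lie_bracket (psi x) (psi y).
Proof. exact: (lie_morph_inv phiK psiK phi_br).2. Qed.

(* The complex structure of h transported to the amalgam; it is only R-linear
   for the given structure. *)
Let scal (c : R[i]) (v : amalgam p) : amalgam p := phi (c *: (psi v : h)).

Let scalD c u v : scal c (u + v) = scal c u + scal c v.
Proof.
have psiD : psi (u + v) = psi u + psi v.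
  by have := psi_lin 1 u v; rewrite !scale1r.
by rewrite /scal psiD scalerDr; exact: (raddfD phi).
Qed.

Let scalA c d v : scal c (scal d v) = scal (c * d) v.
Proof. by rewrite /scal phiK scalerA. Qed.

Let scal_real (a : R) v : scal a%:C v = a%:C *: v.
Proof. by have := linearZZ phi a (psi v); rewrite psiK. Qed.

Let scalE c v : scal c v = (Re c)%:C *: v + (Im c)%:C *: scal 'i v.
Proof.
rewrite -scal_real -[X in _ + X]scal_real scalA.
rewrite {1}[c]complexE [_ * 'i]mulrC /scal scalerDl; exact: (raddfD phi).
Qed.

Let scal_bracketl c v w : scal c (lie_bracket v w) = lie_bracket (scal c v) w.
Proof.
have := phi_br (c *: (psi v : h)) (psi w); rewrite psiK; apply: etrans.
congr (phi _); apply: etrans (esym (@lie_bracketZl _ h c (psi v) (psi w))).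
exact: (congr1 (fun x : h => c *: x) (psi_br v w)).
Qed.

Let scal_bracketr c v w : scal c (lie_bracket v w) = lie_bracket v (scal c w).
Proof.
have := phi_br (psi v) (c *: (psi w : h)); rewrite psiK; apply: etrans.
congr (phi _); apply: etrans (esym (@lie_bracketZr _ h c (psi v) (psi w))).
exact: (congr1 (fun x : h => c *: x) (psi_br v w)).
Qed.

Let J0 := scal 'i.
Let d i := (J0 (gen p (i, true))).1 (i, true).

Let scal0 c : scal c 0 = 0.
Proof. by apply: (addrI (scal c 0)); rewrite -scalD !addr0. Qed.

(** The coordinate is read off by a bracket with [gen p (i, ~~ r)]; once [J0] is pulled out, what
    remains is a bracket of generators that vanishes. So [J0] is diagonal on generators modulo the
    central part. *)
Let scal_gen_off k t i r :
  (k, t) != (i, r) -> (J0 (gen p (k, t))).1 (i, r) = 0.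
Proof.
move=> ne; have [j pij] := p_neq0 i.
have E : lie_bracket (J0 (gen p (k, t))) (gen p (i, ~~ r)) = 0.
  rewrite -scal_bracketl bracket_gen ffunE eq_sym (negbTE ne).
  by rewrite mulr0 scale0r scal0.
move: E; rewrite bracket_gen => E.
have: bsgn _ r * (J0 (gen p (k, t))).1 (i, r) = 0 :> R[i].
  by apply: (pt_scale_inj pij); rewrite E scale0r.
by case: r {ne E} => /eqP; rewrite /bsgn ?mul1r ?mulN1r ?oppr_eq0 => /eqP.
Qed.

(** Move [J0] from one side of a bracket to the other and compare the coefficients of [pt p i]. *)
Let scal_i_coord v i t :
  (J0 v).1 (i, t) = (J0 (gen p (i, ~~ t))).1 (i, ~~ t) * v.1 (i, t).
Proof.
have [j pij] := p_neq0 i.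
have := scal_bracketr 'i v (gen p (i, ~~ t)).
rewrite scal_bracketl bracket_gen.
(* By [scal_gen_off], the transported generator keeps only its own coordinate modulo the central
   part. *)
have -> : lie_bracket v (scal 'i (gen p (i, ~~ t))) =
  (bsgn _ t * ((J0 (gen p (i, ~~ t))).1 (i, ~~ t) * v.1 (i, t))) *: pt p i.
  congr pair; rewrite /= ?scaler0 //; apply/ffunP => k; rewrite !ffunE.
  rewrite (bigD1 i) //= big1 => [|l li].
    have: (J0 (gen p (i, ~~ t))).1 (i, t) = 0.
      by apply: scal_gen_off; rewrite xpair_eqE eqxx; case: t.
    rewrite /symp -/J0; case: t => /= ->; rewrite /GRing.scale /=; ring.
  rewrite /symp -/J0 !scal_gen_off ?xpair_eqE 1?eq_sym ?(negbTE li) //=.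
  by rewrite !mulr0 subrr mul0r.
move/(pt_scale_inj pij).
by case: (t); rewrite /bsgn ?mul1r ?mulN1r // => /oppr_inj.
Qed.

(** Applied to a generator, [scal_i_coord] shows that both diagonal entries of plane [i] are equal.
    Hence [J0], a priori only real linear, acts on the plane as one complex scalar. *)
Let scal_i_diag v i t : (J0 v).1 (i, t) = d i * v.1 (i, t).
Proof.
rewrite scal_i_coord; case: t => //=.
by rewrite (scal_i_coord _ i false) ffunE eqxx mulr1.
Qed.

Let d_sqr i : d i ^+ 2 = 'i ^+ 2.
Proof.
have := scalA 'i 'i (gen p (i, true)).
rewrite -expr2 sqr_i -(rmorphN1 (real_complex R)) scal_real.
move/(congr1 (fun v : amalgam p => v.1 (i, true))).
rewrite !scal_i_diag !ffunE eqxx !mulr1 expr2 => ->.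
by rewrite /GRing.scale /= mulr1.
Qed.

Let s i := d i != 'i.

Let dE i : d i = cj (s i) 'i.
Proof.
have /eqP := d_sqr i; rewrite eqf_sqr /s; case: eqP => [->//|_] /= /eqP ->.
by apply/eqP; rewrite eq_complex /= oppr0 !eqxx.
Qed.

Let cjE i c : (Re c)%:C + (Im c)%:C * d i = cj (s i) c.
Proof. by rewrite {3}[c]complexE dE rmorphD rmorphM /= !cj_real mulrC. Qed.

Let scal_coord1 c v x : (scal c v).1 x = cj (s x.1) c * v.1 x.
Proof.
case: x => i t; rewrite scalE !ffunE scal_i_diag -cjE /= /GRing.scale /=; ring.
Qed.

Let scal_i_pt a i : J0 (a *: pt p i) = (d i * a) *: pt p i.
Proof.
have -> : a *: pt p i = lie_bracket (a *: gen p (i, true)) (gen p (i, ~~ true)).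
  by rewrite bracket_gen !ffunE eqxx /= /GRing.scale /= mul1r mulr1.
rewrite /J0 scal_bracketl bracket_gen scal_i_diag !ffunE eqxx.
by rewrite mul1r /GRing.scale /= mulr1.
Qed.

(** The points selected by [e] are the unit vectors, so the action of [J0] on the central part is
    determined by its action on the planes. *)
Let centralE z : central p z = \sum_j z j *: pt p (e j).
Proof.
apply: amalgam_ext => [x|j].
  by rewrite sum_coord1 big1 ?ffunE // => j _; rewrite /= !ffunE scaler0.
rewrite sum_coord2 (bigD1 j) //= big1 => [|k kj].
  by rewrite !ffunE p_basis eqxx addr0 /GRing.scale /= mulr1.
by rewrite !ffunE p_basis eq_sym (negbTE kj) scaler0.
Qed.

Let scal_sum c (T : finType) (f : T -> amalgam p) :
  scal c (\sum_t f t) = \sum_t scal c (f t).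
Proof. exact: (big_morph (scal c) (scalD c) (scal0 c)). Qed.

Let scal_i_central z : J0 (central p z) = central p [ffun j => d (e j) * z j].
Proof.
rewrite [in LHS]centralE [RHS]centralE /J0 scal_sum.
by apply: eq_bigr => j _; rewrite -/(J0 _) scal_i_pt ffunE.
Qed.

(** Coordinate [j] of [J0 (pt p i)] is computed twice: with the scalar of plane [i], and with that
    of the basis point [e j]. *)
Let s_compat i j : p i j != 0 -> s i = s (e j).
Proof.
move=> pij; have := scal_i_pt 1 i; rewrite scale1r scal_i_central.
move/(congr1 (fun v : amalgam p => v.2 j)); rewrite !ffunE mulr1.
by move/(mulIf pij); rewrite /s => ->.
Qed.

Let scal_central c z :
  scal c (central p z) = central p [ffun j => cj (s (e j)) c * z j].
Proof.
rewrite scalE -/J0 scal_i_central; congr pair.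
  by rewrite /= !scaler0 addr0.
by apply/ffunP => j; rewrite !ffunE -cjE /= /GRing.scale /=; ring.
Qed.

Let p' i j := cj (s i) (p i j).

(* Complex-linear extension of psi on the generators; phi \o F is triangular, with
   conjugations on the diagonal. *)
Let F (v : amalgam p') : h :=
  \sum_x v.1 x *: (psi (gen p x) : h) + \sum_j v.2 j *: (psi (pt p (e j)) : h).

Let F_linear : linear F.
Proof.
move=> a u v; rewrite /F scalerDr addrACA !scaler_sumr -!big_split /=.
by congr (_ + _); apply: eq_bigr => x _; rewrite !ffunE scalerA -scalerDl.
Qed.

Let phiF v : phi (F v) = \sum_x scal (v.1 x) (gen p x)
  + \sum_j scal (v.2 j) (pt p (e j)) :> amalgam p.
Proof. by rewrite /F (raddfD phi) !(raddf_sum phi). Qed.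

Let phiF1 v x : (phi (F v) : amalgam p).1 x = cj (s x.1) (v.1 x).
Proof.
rewrite phiF ffunE !sum_coord1.
rewrite [X in _ + X]big1 ?addr0 => [|j _]; last first.
  by rewrite scal_coord1 ffunE mulr0.
rewrite (bigD1 x) //= big1 ?addr0 => [|y yx]; rewrite scal_coord1 ffunE.
  by rewrite eqxx mulr1.
by rewrite eq_sym (negbTE yx) mulr0.
Qed.

Let phiF_central z :
  phi (F (central p' z)) =
    central p [ffun j => cj (s (e j)) (z j)] :> amalgam p.
Proof.
rewrite phiF [RHS]centralE big1 ?add0r => [|x _]; last first.
  by rewrite ffunE (scal_real 0) scale0r.
apply: eq_bigr => j _; rewrite ffunE /= scal_central; congr pair.
  by rewrite scaler0.
apply/ffunP => k; rewrite !ffunE p_basis.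
by have [->|_] := eqVneq k j; rewrite /GRing.scale /= ?mulr0.
Qed.

Lemma amalgam_complex_structure :
  exists s : I -> bool,
    lie_isomorphic (amalgam (fun i j => cj (s i) (p i j))) h.
Proof.
exists s.
have phiD (x y : h) : phi (x + y : h) = phi x + phi y :> amalgam p.
  exact: (raddfD phi).
have FD u v : F (u + v) = F u + F v.
  by have := F_linear 1 u v; rewrite !scale1r.
have split_amalgam (v : amalgam p') :
    v = ((v.1, 0) : amalgam p') + central p' v.2.
  by case: v => v z; congr pair; rewrite /= ?addr0 ?add0r.
have F_inj : injective F.
  move=> v w Fvw.
  have v1 : v.1 = w.1.
    by apply/ffunP => x; apply: (can_inj (cjK (s x.1))); rewrite -!phiF1 Fvw.
  move: Fvw; rewrite [v in LHS]split_amalgam [w in RHS]split_amalgam v1 !FD.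
  move/addrI/(congr1 phi); rewrite !phiF_central => -[] /ffunP vw2.
  rewrite [v]split_amalgam [w]split_amalgam v1; congr (_ + central _ _).
  apply/ffunP => j; apply: (can_inj (cjK (s (e j)))).
  by have := vw2 j; rewrite !ffunE.
pose a (t : amalgam p) : {ffun I * bool -> R[i]^o} :=
  [ffun x => cj (s x.1) (t.1 x)].
pose r (t : amalgam p) : amalgam p := t - phi (F (a t, 0)).
(* Inverse of the triangular map: first undo the conjugations on the generator part, then on the
   remainder [r], which is central. *)
pose G (y : h) : amalgam p' := let t : amalgam p := phi y in
  (a t, [ffun j => cj (s (e j)) ((r t).2 j)]).
have GK : cancel G F.
  move=> y; apply: (can_inj phiK); rewrite [G y]split_amalgam FD phiD.
  rewrite phiF_central /=; set t : amalgam p := phi y.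
  rewrite -[RHS](subrK (phi (F (a t, 0))) t) addrC; congr (_ + _).
  congr pair; apply/ffunP => x; rewrite !ffunE ?cjK //.
  by rewrite phiF1 ffunE cjK subrr.
apply: (@lie_isomorphicI _ _ _ F F_linear).
  by exists G => // v; apply: F_inj; rewrite GK.
move=> v w; apply: (can_inj phiK).
rewrite (phi_br (F v) (F w)) [LHS]phiF_central; congr pair.
apply/ffunP => j; rewrite !ffunE rmorph_sum; apply: eq_bigr => i _.
rewrite /symp !phiF1 /= rmorphM /p'.
(* A nonzero [p i j] forces the sign of coordinate [j] to be that of plane [i], so conjugating twice
   restores [p i j]. *)
have [->|/s_compat <-] := eqVneq (p i j) 0; first by rewrite !rmorph0 !mulr0.
by rewrite cjK rmorphB !rmorphM.
Qed.

End Classification.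
End Conjugation.

(** * Isomorphisms of amalgams and the lines of their points *)

Lemma amalgam_iso_points (K : fieldType) (I J I' J' : finType)
    (p : I -> J -> K) (p' : I' -> J' -> K)
    (f : {linear amalgam p -> amalgam p'}) :
  (forall i, exists j, p i j != 0) -> (forall i, exists j, p' i j != 0) ->
  bijective f ->
  (forall v w, f (lie_bracket v w) = lie_bracket (f v) (f w)) ->
  forall i, exists kc : I' * K, kc.2 != 0 /\ f (pt p i) = kc.2 *: pt p' kc.1.
Proof.
move=> p_neq0 p'_neq0 [f' fK f'K] f_br i.
have [j pij] := p_neq0 i.
(* [x, _] has rank one, and any nonzero coordinate of x in plane k puts a
   multiple of p'_k in its image. *)
pose x := f (gen p (i, ~~ false)).
have x_rank1 w : exists a : K, lie_bracket x w = a *: f (pt p i).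
  exists (- (bsgn K false * (f' w).1 (i, false))).
  by rewrite -linearZ -gen_bracket f_br f'K.
have [y xy0|x0] := pickP (fun y => x.1 y != 0).
  case: y xy0 => k t xkt; have [j' pkj'] := p'_neq0 k.
  have [a] := x_rank1 (gen p' (k, ~~ t)); rewrite bracket_gen.
  set b := _ * _ => ba; have b0 : b != 0.
    by rewrite mulf_neq0 // /bsgn; case: (t); rewrite ?oppr_eq0 oner_neq0.
  have a0 : a != 0.
    apply: contra_neq b0 => a0; apply: (pt_scale_inj pkj').
    by rewrite ba a0 !scale0r.
  exists (k, a^-1 * b); split; first by rewrite mulf_neq0 ?invr_eq0.
  by rewrite -scalerA ba scalerA mulVf // scale1r.
(* Otherwise [x] is central and kills every bracket, although [f] is injective and [pt p i] is a
   nonzero bracket. *)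
have: f (lie_bracket (gen p (i, true)) (gen p (i, ~~ true))) = 0.
  rewrite f_br -/x; apply: amalgam_ext => [y|k]; rewrite !ffunE //.
  rewrite big1 // => l _.
  by rewrite /symp !(eqP (negbFE (x0 _))); ring.
rewrite -(linear0 f) bracket_gen => /(can_inj fK) /eqP.
rewrite ffunE eqxx mulr1 scale1r -[pt p i]scale1r -(scale0r (pt p i)).
by move/eqP/(pt_scale_inj pij)/eqP; rewrite oner_eq0.
Qed.

(** * Cross ratios and sums of quadruples *)

Section Quadruples.
Variable R : realType.

(* The vectors (1,0), (0,1), (1,1), (1,l); true is the second coordinate. *)
Definition quad (l : R[i]) (k : 'I_4) (j : bool) : R[i] :=
  if j then [:: 0; 1; 1; l]`_k else [:: 1; 0; 1; 1]`_k.

Definition quad_det (l : R[i]) (k k' : 'I_4) : R[i] :=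
  quad l k false * quad l k' true - quad l k true * quad l k' false.

(** With denominators cleared, this says that the reordered cross ratio is not [2 * 'i]. Every
    ordering is checked through real and imaginary parts. *)
Lemma quad_cross_ratio (l : R[i]) (k : 'I_4 -> 'I_4) :
  injective k -> l = 2 \/ l = - (2 * 'i) ->
  2 * 'i * quad_det l (k 0) (k 2) * quad_det l (k 1) (k 3) <>
  quad_det l (k 0) (k 3) * quad_det l (k 1) (k 2).
Proof.
move=> k_inj l_val.
have ne i j : i != j -> k i != k j by rewrite (inj_eq k_inj).
have := And4 (ne 0 1 isT) (ne 0 2 isT) (ne 0 3 isT) (ne 1 2 isT).
have := conj (ne 1 3 isT) (ne 2 3 isT).
move: (k 0) (k 1) (k 2) (k 3) => k0 k1 k2 k3 {ne} [+ +] [].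
case: l_val => ->; case: k0 => [[|[|[|[|//]]]] ?];
  case: k1 => [[|[|[|[|//]]]] ?] //; case: k2 => [[|[|[|[|//]]]] ?] //;
  case: k3 => [[|[|[|[|//]]]] ?] // _ _ _ _ _ _ /eqP;
  rewrite /quad_det /quad eq_complex /= => /andP[/eqP ? /eqP ?]; lra.
Qed.

Implicit Types x : R[i].

(** Away from 0 and 1, the four vectors give distinct points of the projective line. *)
Lemma quad_det_eq0 x k k' :
  x != 0 -> x != 1 -> quad_det x k k' = 0 -> k = k'.
Proof.
move=> x0 x1; case: k k' => [[|[|[|[|//]]]] ?] [[|[|[|[|//]]]] ?];
  rewrite /quad_det /quad /= ?(mulr0, mulr1, mul0r, mul1r, subr0, sub0r);
  move/eqP; rewrite ?oppr_eq0 ?subr_eq0 ?oner_eq0;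
  rewrite ?(negbTE x0) ?(eq_sym 1) ?(negbTE x1) //;
  by move=> _; apply: val_inj.
Qed.

(** The scaled vectors satisfy the relations of (1,0), (0,1), (1,1), (1,x), so their cross ratio is
    [x]. *)
Lemma quad_det_cross_ratio x y (k : 'I_4 -> 'I_4) (c : 'I_4 -> R[i]) :
  (forall r, c r != 0) ->
  (forall j, c 0 * quad y (k 0) j + c 1 * quad y (k 1) j
     = c 2 * quad y (k 2) j) ->
  (forall j, c 0 * quad y (k 0) j + x * (c 1 * quad y (k 1) j)
     = c 3 * quad y (k 3) j) ->
  x * quad_det y (k 0) (k 2) * quad_det y (k 1) (k 3) =
  quad_det y (k 0) (k 3) * quad_det y (k 1) (k 2).
Proof.
(* The factor [c 2 * c 3] lets the relations be substituted into the determinants. *)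
move=> c0 E2 E3; apply: (mulfI (mulf_neq0 (c0 2) (c0 3))).
pose q r := quad y (k r).
transitivity (x * (q 0 false * (c 2 * q 2 true) - q 0 true * (c 2 * q 2 false))
  * (q 1 false * (c 3 * q 3 true) - q 1 true * (c 3 * q 3 false))).
  rewrite /quad_det /q; ring.
transitivity ((q 0 false * (c 3 * q 3 true) - q 0 true * (c 3 * q 3 false))
  * (q 1 false * (c 2 * q 2 true) - q 1 true * (c 2 * q 2 false))); last first.
  rewrite /quad_det /q; ring.
rewrite /q -!E2 -!E3; ring.
Qed.

Variable B : finType.
Implicit Types l : B -> R[i].

Definition quads l (i : B * 'I_4) (j : B * bool) : R[i] :=
  if j.1 == i.1 then quad (l i.1) i.2 j.2 else 0.

(** The vectors (1,0) and (0,1) of each block; they serve as [e] in the classification, whatever [l]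
    is. *)
Definition quad_axis (j : B * bool) : B * 'I_4 := (j.1, inord j.2).

Lemma quads_axis l j j' : quads l (quad_axis j) j' = (j' == j)%:R.
Proof.
case: j j' => b t [b' t']; rewrite /quads /quad_axis xpair_eqE /=.
have [_|//] := eqVneq b' b.
by rewrite /quad inordK; case: t t' => -[].
Qed.

Lemma quad_neq0 (x : R[i]) k : exists j, quad x k j != 0.
Proof.
have [k1|k1] := eqVneq k 1.
  by exists true; rewrite /quad k1 /= oner_neq0.
exists false; move: k1; case: k => [[|[|[|[|//]]]] ?] // _;
by rewrite /quad /= oner_neq0.
Qed.

Lemma quads_neq0 l i : exists j, quads l i j != 0.
Proof.
by have [t ?] := quad_neq0 (l i.1) i.2; exists (i.1, t); rewrite /quads eqxx.
Qed.

Lemma quads_inj l i i' a :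
  (forall b, l b != 0) -> (forall b, l b != 1) ->
  pt (quads l) i = a *: pt (quads l) i' -> i = i'.
Proof.
move=> l0 l1 /(congr1 snd) /= /ffunP E.
have {}E j : quads l i j = a * quads l i' j by have := E j; rewrite !ffunE.
case: i i' E => b k [b' k'] E.
have bb' : b = b'.
  have [t] := quad_neq0 (l b) k; have := E (b, t); rewrite /quads /= eqxx.
  by case: eqVneq => // _ ->; rewrite mulr0 eqxx.
subst b'; congr (_, _); apply: (quad_det_eq0 (l0 b) (l1 b)).
rewrite /quad_det; have := E (b, true); have := E (b, false).
by rewrite /quads /= eqxx => -> ->; ring.
Qed.

(** Blocks are in direct sum, so a three-term relation with nonzero coefficients stays in one block:
    test it at a nonzero coordinate of each vector. *)
Lemma quads_circuit l i0 i1 i2 a b c : a != 0 -> b != 0 -> c != 0 ->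
  (forall j, a * quads l i0 j + b * quads l i1 j = c * quads l i2 j) ->
  i0.1 = i2.1 /\ i1.1 = i2.1.
Proof.
move=> a0 b0 c0 E.
have [t0 q0] := quad_neq0 (l i0.1) i0.2; have := E (i0.1, t0).
have [t1 q1] := quad_neq0 (l i1.1) i1.2; have := E (i1.1, t1).
have [t2 q2] := quad_neq0 (l i2.1) i2.2; have := E (i2.1, t2).
rewrite /quads /= !eqxx [i1.1 == i0.1]eq_sym ![i2.1 == _]eq_sym.
case: (eqVneq i0.1 i1.1) => [->|_]; last first.
  case: (eqVneq i0.1 i2.1) => [|_ _ _] //.
    case: (eqVneq i1.1 i2.1) => // _ _ _ /eqP.
    by rewrite !mulr0 add0r mulf_eq0 (negbTE b0) (negbTE q1).
  by move/eqP; rewrite !mulr0 addr0 mulf_eq0 (negbTE a0) (negbTE q0).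
case: (eqVneq i1.1 i2.1) => // _ /esym/eqP.
by rewrite !mulr0 addr0 mulf_eq0 (negbTE c0) (negbTE q2).
Qed.

(** The isomorphism induces an injection [k] on indices, which sends blocks of parameter [2 * 'i]
    into such blocks. Counting vectors instead of blocks makes it unnecessary to extract a map of
    blocks. *)
Lemma quads_iso_card l l' :
  (forall b, l b != 0) -> (forall b, l b != 1) ->
  (forall b, [\/ l' b = 2 * 'i, l' b = 2 | l' b = - (2 * 'i)]) ->
  lie_isomorphic (amalgam (quads l)) (amalgam (quads l')) ->
  (#|[set i : B * 'I_4 | l i.1 == (2 * 'i)%R]| <=
    #|[set i : B * 'I_4 | l' i.1 == (2 * 'i)%R]|)%N.
Proof.
move=> l0 l1 l'_val [f [f_bij f_br]].
have [kc kcP] := fin_all_exists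
  (amalgam_iso_points (quads_neq0 l) (quads_neq0 l') f_bij f_br).
pose k i := (kc i).1; pose c i := (kc i).2.
have c0 i : c i != 0 by case: (kcP i).
have fpt i : f (pt _ i) = c i *: pt _ (k i) by case: (kcP i).
have k_inj : injective k.
  move=> i i' kii'; apply: (@quads_inj l _ _ (c i / c i')) => //.
  apply: (bij_inj f_bij).
  by rewrite linearZ /= !fpt kii' scalerA divfK.
have fpt2 i j : c i * quads l' (k i) j = (f (pt _ i)).2 j by rewrite fpt !ffunE.
have E2 b j : c (b, 0) * quads l' (k (b, 0)) j
    + c (b, 1) * quads l' (k (b, 1)) j = c (b, 2) * quads l' (k (b, 2)) j.
  rewrite !fpt2; have -> : pt (quads l) (b, 2) = pt _ (b, 0) + pt _ (b, 1).
    apply: amalgam_ext => [x|[b' t]]; rewrite !ffunE ?addr0 //= /quads /=.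
    case: eqVneq => _; rewrite ?addr0 // /quad.
    by case: t; rewrite /= ?add0r ?addr0.
  by rewrite linearD ffunE.
have E3 b j : c (b, 0) * quads l' (k (b, 0)) j
    + l b * (c (b, 1) * quads l' (k (b, 1)) j)
      = c (b, 3) * quads l' (k (b, 3)) j.
  rewrite !fpt2.
  have -> : pt (quads l) (b, 3) = pt _ (b, 0) + l b *: pt _ (b, 1).
    apply: amalgam_ext => [x|[b' t]]; rewrite !ffunE /= ?scaler0 ?addr0 //=.
    rewrite /quads /=.
    case: eqVneq => _; rewrite ?scaler0 ?addr0 // /quad /GRing.scale.
    by case: t; rewrite /= ?mulr1 ?mulr0 ?add0r ?addr0.
  by rewrite linearD linearZ !ffunE.
rewrite -(card_imset _ k_inj) subset_leq_card //.
apply/fintype.subsetP => _ /imsetP[[b r] + ->]; rewrite !inE /= => /eqP lb.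
(* The two relations of block [b] are transported by [f]; they keep its four images in one block. *)
have [b0 b1] := quads_circuit (c0 _) (c0 _) (c0 _) (E2 b).
have [b0' b1'] : (k (b, 0)).1 = (k (b, 3)).1 /\ (k (b, 1)).1 = (k (b, 3)).1.
  apply: (@quads_circuit l' _ _ _ (c (b, 0)) (l b * c (b, 1)) (c (b, 3))) => //.
    by rewrite mulf_neq0.
  by move=> j; rewrite -E3 mulrA.
have kb t : (k (b, t)).1 = (k (b, 0)).1.
  case: t => [[|[|[|[|//]]]] t4].
  - by congr (k (_, _)).1; apply: val_inj.
  - by rewrite b0 -b1; congr (k (_, _)).1; apply: val_inj.
  - by rewrite b0; congr (k (_, _)).1; apply: val_inj.
  - by rewrite b0'; congr (k (_, _)).1; apply: val_inj.
rewrite kb; have [//|l'b] := eqVneq (l' (k (b, 0)).1) (2 * 'i).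
have k2_inj : injective (fun t => (k (b, t)).2).
  move=> t t' tt'; have /k_inj[//] : k (b, t) = k (b, t').
  by rewrite [LHS]surjective_pairing [RHS]surjective_pairing !kb tt'.
have qE t u : quads l' (k (b, t)) ((k (b, 0)).1, u) =
    quad (l' (k (b, 0)).1) (k (b, t)).2 u.
  by rewrite /quads /= (kb t) eqxx.
(* If the target parameter were 2 or [- (2 * 'i)], reordering its quadruple would produce the cross
   ratio [2 * 'i]. *)
case: (@quad_cross_ratio (l' (k (b, 0)).1) _ k2_inj).
  case: (l'_val (k (b, 0)).1) => [/eqP|->|->]; [|by left|by right].
  by rewrite (negbTE l'b).
rewrite -lb; apply: (@quad_det_cross_ratio _ _ (fun t => (k (b, t)).2)
  (fun t => c (b, t))) => //= u.
  by have := E2 b ((k (b, 0)).1, u); rewrite !qE.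
by have := E3 b ((k (b, 0)).1, u); rewrite !qE.
Qed.

End Quadruples.

(** * Sign patterns on the blocks and their normal forms *)

Section SignedQuads.
Variables (R : realType) (m : nat).
Implicit Types s : 'I_m -> bool.

(* The block None, with a real parameter, only ensures that the algebra is not
   abelian when n = 1. *)
Definition sign_param s (b : option 'I_m) : R[i] :=
  if b is Some b' then (if s b' then 2 * 'i else - (2 * 'i)) else 2.

Definition signed_quads s := amalgam (quads (sign_param s)).

Let im_neq_real (x : R) : 2 * 'i != x%:C /\ - (2 * 'i) != x%:C.
Proof.
by split; apply/eqP => /eqP; rewrite eq_complex /= => /andP[_ /eqP]; lra.
Qed.

Let sign_param_val s b :
  [\/ sign_param s b = 2 * 'i, sign_param s b = 2
    | sign_param s b = - (2 * 'i)].
Proof.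
case: b => [b|] /=; last by constructor 2.
by case: (s b); [constructor 1|constructor 3].
Qed.

Let sign_param_neq0 s b : sign_param s b != 0.
Proof.
have [] := im_neq_real 0; rewrite rmorph0.
by case: (sign_param_val s b) => -> // _ _; rewrite Num.Theory.pnatr_eq0.
Qed.

Let sign_param_neq1 s b : sign_param s b != 1.
Proof.
have [] := im_neq_real 1; rewrite rmorph1.
by case: (sign_param_val s b) => -> // _ _; rewrite (Num.Theory.eqr_nat _ 2 1).
Qed.

Let cj_2i c : cj R c (2 * 'i) = if c then - (2 * 'i) else 2 * 'i.
Proof.
case: c => //; apply/eqP; rewrite eq_complex /=.
by apply/andP; split; apply/eqP; ring.
Qed.

Let cj_sign_param c s s' b : s' b = c (+) s b ->
  sign_param s' (Some b) = cj R c (sign_param s (Some b)).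
Proof.
move=> /= ->; case: (s b); rewrite ?rmorphN /= cj_2i;
  by case: c; rewrite /= ?opprK.
Qed.

Let cj_2 c : cj R c 2 = 2.
Proof. exact: rmorph_nat. Qed.

(** Conjugate exactly the blocks on which the signs differ; distinct blocks share no coordinate. *)
Lemma signed_quads_realification s s' :
  lie_isomorphic (realification (signed_quads s))
    (realification (signed_quads s')).
Proof.
pose c (b : option 'I_m) := if b is Some b' then s b' (+) s' b' else false.
apply: (@amalgam_conj _ _ _ _ _ (fun i => c i.1) (fun j => c j.1)).
  move=> [b k] [b' t]; rewrite /quads /=.
  case: eqVneq => _; last by rewrite rmorph0.
  have -> : sign_param s b = cj R (c b) (sign_param s' b).
    case: b => [b|] //; apply: cj_sign_param.
    by rewrite /= addbK.
  by case: k => [[|[|[|[|//]]]] ?]; rewrite /quad; case: t;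
    rewrite /= ?rmorph1 ?rmorph0.
move=> [b k] [b' t]; rewrite /quads /=.
by case: (eqVneq b' b) => [->//|_]; rewrite eqxx.
Qed.

Lemma signed_quads_classification s h :
  bi_invariant_on (realification (signed_quads s)) h ->
  exists s', lie_isomorphic h (signed_quads s').
Proof.
move=> [f [[f' fK f'K] f_br]].
have [c c_iso] := amalgam_complex_structure (quads_neq0 (sign_param s))
  (quads_axis (sign_param s)) fK f'K f_br.
(* Only vector 3 of a block can have a nonreal entry, so its conjugation bit decides the new
   sign. *)
exists (fun b => c (Some b, 3) (+) s b).
apply: lie_isomorphic_sym; apply: lie_isomorphic_trans c_iso.
have id_bij T : bijective (@id T) by exists id.
(* Reindexing along identities turns pointwise equality of the vectors into an isomorphism. *)
apply: (amalgam_reindex (id_bij _) (id_bij _)) => -[b k] [b' t].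
rewrite /quads /=; case: eqVneq => _; last by rewrite rmorph0.
case: k => [[|[|[|[|//]]]] k4]; rewrite /quad; case: t;
  rewrite /= ?rmorph1 ?rmorph0 //.
have -> : Ordinal k4 = 3 by apply: val_inj.
by case: b => [b|]; [apply: cj_sign_param|rewrite /= cj_2].
Qed.

Lemma signed_quads_perm s s' (u : 'S_m) : (forall b, s' (u b) = s b) ->
  lie_isomorphic (signed_quads s') (signed_quads s).
Proof.
move=> s'u; have u_bij : bijective (omap u).
  by exists (omap u^-1%g); case=> [b|] //=; rewrite ?permK ?permKV.
have pair_bij T : bijective (fun x : option 'I_m * T => (omap u x.1, x.2)).
  have [v uK vK] := u_bij.
  by exists (fun x => (v x.1, x.2)); case=> b t /=; rewrite ?uK ?vK.
apply: (amalgam_reindex (pair_bij _) (pair_bij _)) => -[b k] [b' t].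
rewrite /quads /= (bij_eq u_bij); case: eqVneq => // _; congr quad.
by case: b => //= b; rewrite s'u.
Qed.

(** Normal form of a sign pattern up to permutation of the blocks: the positive signs come first. *)
Definition initial_sign (a : nat) (b : 'I_m) : bool := (b < a)%N.

Lemma initial_sign_perm s :
  exists (a : 'I_m.+1) (u : 'S_m), forall b, initial_sign a (u b) = s b.
Proof.
pose a := #|[pred b | s b]|.
have am : (a < m.+1)%N by rewrite ltnS -[X in (_ <= X)%N]card_ord max_card.
exists (Ordinal am).
have card_a : #|[pred b | initial_sign a b]| = a.
  rewrite -sum1_card (eq_bigl (fun b : 'I_m => (b < a)%N)) //.
  by rewrite -(big_ord_widen m (fun=> 1%N)) // sum_nat_const card_ord muln1.
(* Two boolean tuples are permutations of each other once they contain [true] equally often. *)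
have : perm_eq [tuple s b | b < m] [tuple initial_sign a b | b < m].
  have cnt c (f : 'I_m -> bool) : count_mem c [tuple f b | b < m] =
      if c then #|[pred b | f b]| else (m - #|[pred b | f b]|)%N.
    have countE (P : pred 'I_m) : count P (enum 'I_m) = #|P|.
      by rewrite enumT cardE [in RHS]/enum_mem size_filter; apply: eq_count.
    rewrite count_map countE; case: c.
      by apply: eq_card => b; rewrite !inE eqb_id.
    rewrite -[m in (m - _)%N]card_ord -(cardC [pred b | f b]) addKn.
    by apply: eq_card => b; rewrite !inE eqbF_neg.
  by apply/allP => c _ /=; rewrite !cnt card_a.
move=> /tuple_permP[u uE]; exists u => b.
move/(congr1 (fun t => nth true t b)): uE.
rewrite -!tnth_nth !tnth_mktuple.
by move=> ->.
Qed.

(** The number of vectors in blocks of parameter [2 * 'i] grows strictly with the number of positive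
    signs. *)
Lemma initial_sign_iso_leq (a a' : 'I_m.+1) :
  lie_isomorphic (signed_quads (initial_sign a))
    (signed_quads (initial_sign a')) ->
  (a <= a')%N.
Proof.
move/(quads_iso_card (sign_param_neq0 _) (sign_param_neq1 _)
  (sign_param_val _)).
apply: contraTT; rewrite -!ltnNge => a'a; apply: proper_card.
have Im_sign s b :
    (sign_param s b == 2 * 'i) = if b is Some b' then s b' else false.
  case: b => [b|] /=.
    case: (s b); rewrite ?eqxx //; apply/negP.
    by rewrite eq_complex /= => /andP[_ /eqP]; lra.
  rewrite eq_sym; apply: negbTE; have [] := im_neq_real 2.
  by rewrite rmorph_nat.
have a'm : (a' < m)%N by rewrite (leq_trans a'a) // -ltnS.
apply/properP; split.
  apply/fintype.subsetP => -[[b|] k]; rewrite !inE !Im_sign // /initial_sign.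
  by move=> /leq_trans; apply; apply: ltnW.
(* Position [a'] is positive in the pattern of [a], but is the first negative one in that of
   [a']. *)
exists (Some (Ordinal a'm), 0); rewrite !inE !Im_sign //= /initial_sign /=.
by rewrite ltnn.
Qed.

End SignedQuads.

Theorem corollary5p5 :
  forall (R : realType) (n : nat), (1 <= n)%N ->
    exists m : lieAlgType R,
      [/\ finite_dimensional m, step_nilpotent 2 m
        & exactly_n_bi_invariant m n].
Proof.
(* For [n = m + 1], take [m] signed blocks: the number of positive signs then has [m + 1] possible
   values. *)
move=> R [//|m] _.
pose g (a : 'I_m.+1) := signed_quads R (initial_sign (m := m) a).
exists (realification (g ord0)); split.
- apply: finite_dimensional_realification.
  exact: amalgam_finite_dimensional.
- have [j pj] := quads_neq0 (sign_param R (initial_sign (m := m) 0)) (None, 0).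
  exact: amalgam_realification_step2 pj.
exists g; split=> [a|a a' iso_g|h h_inv].
- exact: signed_quads_realification.
- apply: val_inj; apply/eqP; rewrite eqn_leq.
  apply/andP; split; apply: (@initial_sign_iso_leq R) => //.
  exact: lie_isomorphic_sym.
have [s h_iso] := signed_quads_classification h_inv.
have [a [u au]] := initial_sign_perm s; exists a.
apply: lie_isomorphic_trans h_iso _; apply: lie_isomorphic_sym.
exact: signed_quads_perm au.
Qed.
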